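(* Let $d$ be a positive integer and $J\subsetneq I$ nonzero square free monomial ideals of $S=K[x_1,\ldots,x_n]$, where $I$ is generated by square free monomials of degrees $\geq d$ and $J$ is generated by square free monomials of degrees $\geq d+1$. If $$\rho_d(I)>\rho_{d+1}(I)-\rho_{d+1}(J),$$ i.e. the number of square free monomials of degree $d$ in $I$ exceeds the number of square free monomials of degree $d+1$ in $I\setminus J$, then $\operatorname{depth}_S I/J=d$. This holds for every field $K$, independently of its characteristic.
   Context: $S=K[x_1,\ldots,x_n]$ is the polynomial ring over a field $K$; for a monomial ideal $L$, $\rho_k(L)$ denotes the number of square free monomials of degree $k$ belonging to $L$; depth is taken over $S$. *)

(* Defs.v *)
From HB Require Import structures.
From mathcomp Require Import all_boot all_order all_algebra.
From Stdlib Require Import Classical ClassicalEpsilon.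
Set Implicit Arguments. Unset Strict Implicit. Unset Printing Implicit Defensive.
Import GRing.Theory.
Local Open Scope ring_scope.

Fixpoint mpoly (K : fieldType) (n : nat) : comNzRingType :=
  match n with
  | 0 => K
  | n'.+1 => {poly mpoly K n'}
  end.

Fixpoint xvar (K : fieldType) (n : nat) (i : nat) {struct n} : mpoly K n :=
  match n return mpoly K n with
  | 0 => 0
  | n'.+1 => if i == n' then ('X : {poly mpoly K n'}) else (xvar K n' i)%:P
  end.

Definition sqfmono (K : fieldType) (n : nat) (A : {set 'I_n}) : mpoly K n :=
  \prod_(i in A) xvar K n i.

Definition in_ideal (R : comNzRingType) (gs : seq R) (f : R) : Prop :=
  exists c : 'I_(size gs) -> R, f = \sum_(j < size gs) c j * gs`_j.

Definition sqf_ideal (K : fieldType) (n : nat) (G : seq {set 'I_n}) : mpoly K n -> Prop :=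
  in_ideal (map (@sqfmono K n) G).

Definition max_ideal (K : fieldType) (n : nat) : mpoly K n -> Prop :=
  in_ideal [seq xvar K n i | i <- iota 0 n].

Definition pbool (P : Prop) : bool :=
  if excluded_middle_informative P then true else false.

Definition rho (K : fieldType) (n : nat) (k : nat) (L : mpoly K n -> Prop) : nat :=
  #|[set A : {set 'I_n} | (#|A| == k) && pbool (L (sqfmono K A))]|.

Section Depth.
Variable R : comNzRingType.
(* M = I/J with J ⊆ I ideals of R. *)
Variables I J : R -> Prop.

(* u in I represents an element of (fs)M, i.e. u ∈ (fs)I + J *)
Definition in_submod (fs : seq R) (u : R) : Prop :=
  exists g : 'I_(size fs) -> R,
    (forall j, I (g j)) /\ J (u - \sum_(j < size fs) fs`_j * g j).

Definition regular_seq (fs : seq R) : Prop :=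
  (forall k, (k < size fs)%N ->
     forall u, I u -> in_submod (take k fs) (fs`_k * u) -> in_submod (take k fs) u)
  /\ (exists u, I u /\ ~ in_submod fs u).

Definition depth_eq (m : R -> Prop) (d : nat) : Prop :=
  (exists fs : seq R, size fs = d /\ (forall j, (j < size fs)%N -> m fs`_j) /\ regular_seq fs)
  /\ ~ (exists fs : seq R, size fs = d.+1 /\ (forall j, (j < size fs)%N -> m fs`_j) /\ regular_seq fs).
End Depth.

(* Main.v *)
Require Import Defs.
From HB Require Import structures.
From mathcomp Require Import all_boot all_order all_algebra.
From mathcomp Require Import ring.
From Stdlib Require Import Classical ClassicalEpsilon.
Set Implicit Arguments. Unset Strict Implicit. Unset Printing Implicit Defensive.
Import GRing.Theory.
Local Open Scope ring_scope.

(* Lower bound. Adding to J one by one the square free monomials x_B of I \ J, in order of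
   decreasing degree, filters I/J by shifts of the polynomial rings K[x_i : i in B] with
   |B| >= d. On each of them the elementary symmetric polynomials e_1, ..., e_d of all the
   variables form a regular sequence: modulo e_1, ..., e_(j-1), e_j agrees up to sign with the
   complete symmetric polynomial h_j of the first |B| - j + 1 variables, which is monic in the
   last of them. Regularity passes to extensions.

   Upper bound. The Koszul chains sum_B y_B x_B e_(complement of B), where B runs over the sets of
   size d with x_B in I, have boundaries with one coefficient for each x_C in I \ J with
   |C| = d + 1. Hence some y <> 0 gives a cycle over I/J; it is not a boundary because
   boundaries have degree at least d + 1. An M-regular sequence of length d + 1 in the maximal
   ideal would push this class of H_(n-d) up to a nonzero class of H_(n+1) = 0. *)

(** * Ideals and weakly regular sequences *)

Section Ideals.
Variable R : comNzRingType.
Implicit Types (P I J L : R -> Prop) (fs gs : seq R) (u v f : R).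

Definition ideal P :=
  [/\ P 0, forall u v, P u -> P v -> P (u + v) & forall a u, P u -> P (a * u)].

Lemma ideal0 P : ideal P -> P 0. Proof. by case. Qed.

Lemma idealD P u v : ideal P -> P u -> P v -> P (u + v).
Proof. by case=> _ + _; apply. Qed.

Lemma idealM P a u : ideal P -> P u -> P (a * u).
Proof. by case=> _ _; apply. Qed.

Lemma ideal_mulr P a u : ideal P -> P u -> P (u * a).
Proof. by rewrite mulrC; apply: idealM. Qed.

Lemma idealN P u : ideal P -> P u -> P (- u).
Proof. by move=> iP Pu; rewrite -mulN1r; apply: idealM. Qed.

Lemma idealB P u v : ideal P -> P u -> P v -> P (u - v).
Proof. by move=> iP Pu Pv; apply: idealD => //; apply: idealN. Qed.

Lemma ideal_sub P u v : ideal P -> P (u - v) -> P v -> P u.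
Proof. by move=> iP Puv Pv; rewrite -(subrK v u); apply: idealD. Qed.

Lemma ideal_sum P (T : Type) (r : seq T) (Q : pred T) (F : T -> R) :
  ideal P -> (forall i, Q i -> P (F i)) -> P (\sum_(i <- r | Q i) F i).
Proof.
move=> iP PF; elim/big_ind: _ => //; first exact: ideal0.
by move=> u v; apply: idealD.
Qed.

Lemma idealT : ideal (fun _ => True). Proof. by split. Qed.

Lemma ideal_eq0 : ideal (fun u : R => u = 0).
Proof. by split=> [|u v -> ->|a u ->] //; rewrite ?addr0 ?mulr0. Qed.

Lemma in_idealP gs f : in_ideal gs f <->
  exists c : nat -> R, f = \sum_(j < size gs) c j * gs`_j.
Proof.
split=> [[c ->]|[c ->]]; last by exists (fun j => c j).
exists (fun j => if insub j is Some o then c o else 0).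
by apply: eq_bigr => j _; rewrite valK.
Qed.

Lemma in_ideal_ideal gs : ideal (in_ideal gs).
Proof.
split.
- by exists (fun=> 0); rewrite big1 // => j _; rewrite mul0r.
- move=> _ _ [c ->] [c' ->]; exists (fun j => c j + c' j).
  by rewrite -big_split; apply: eq_bigr => j _; rewrite mulrDl.
- move=> a _ [c ->]; exists (fun j => a * c j).
  by rewrite mulr_sumr; apply: eq_bigr => j _; rewrite mulrA.
Qed.

Lemma in_ideal_gen gs f : f \in gs -> in_ideal gs f.
Proof.
move=> fgs; exists (fun j => (j == index f gs :> nat)%:R).
have lt_f : (index f gs < size gs)%N by rewrite index_mem.
rewrite (bigD1 (Ordinal lt_f)) //= eqxx mul1r nth_index // big1 ?addr0 // => j.
by rewrite -val_eqE /= => /negbTE ->; rewrite mul0r.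
Qed.

Lemma in_ideal_sub gs P : ideal P -> (forall f, f \in gs -> P f) ->
  forall f, in_ideal gs f -> P f.
Proof.
move=> iP gsP _ [c ->]; apply: ideal_sum => // j _.
by apply: idealM => //; apply/gsP/mem_nth.
Qed.

(** Coefficients indexed by all of [nat] can be shifted when [fs] grows, with no cast between
    ordinal types. *)
Lemma in_submodP I J fs u : in_submod I J fs u <->
  exists g : nat -> R, (forall j, (j < size fs)%N -> I (g j)) /\
    J (u - \sum_(j < size fs) fs`_j * g j).
Proof.
split=> [[g [Ig Ju]]|[g [Ig Ju]]]; last by exists (fun j => g j); split=> // j; apply: Ig.
exists (fun j => if insub j is Some o then g o else 0); split=> [j ltj|].
  by rewrite insubT.
by under eq_bigr => j _ do rewrite valK.
Qed.

Lemma in_submod_nil I J u : in_submod I J [::] u <-> J u.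
Proof.
rewrite in_submodP; split=> [[g [_]]|Ju]; first by rewrite big_ord0 subr0.
by exists (fun=> 0); rewrite big_ord0 subr0.
Qed.

Lemma in_submod_cons I J f fs u :
  in_submod I J (f :: fs) u <-> exists2 g, I g & in_submod I J fs (u - f * g).
Proof.
split=> [/in_submodP[g [Ig]]|[g0 Ig0 /in_submodP[g [Ig Ju]]]].
  rewrite /= big_ord_recl /= opprD addrA => Ju; exists (g 0%N); first exact: Ig.
  by apply/in_submodP; exists (fun j => g j.+1); split=> // j ltj; apply: Ig.
apply/in_submodP; exists (fun j => if j is j'.+1 then g j' else g0).
by split=> [[|j] //|]; [apply: Ig | rewrite /= big_ord_recl /= opprD addrA].
Qed.

Lemma in_submod_rcons I J f fs u :
  in_submod I J (rcons fs f) u <-> exists2 g, I g & in_submod I J fs (u - f * g).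
Proof.
elim: fs u => [|f0 fs IH] u /=; first exact: in_submod_cons.
split.
  move/in_submod_cons=> [g Ig /IH [g' Ig' Ju]]; exists g' => //.
  by apply/in_submod_cons; exists g => //; rewrite addrAC.
move=> [g Ig /in_submod_cons [g' Ig' Ju]].
apply/in_submod_cons; exists g' => //; apply/IH; exists g => //.
by rewrite addrAC.
Qed.

Lemma in_submod_ideal I J fs : ideal I -> ideal J -> ideal (in_submod I J fs).
Proof.
move=> iI iJ; elim: fs => [|f fs IH].
  split=> [|u v|a u]; rewrite !in_submod_nil; [exact: ideal0 | exact: idealD | exact: idealM].
split=> [|u v|a u]; rewrite !in_submod_cons.
- by exists 0; [exact: ideal0 | rewrite mulr0 subr0; apply: ideal0].
- move=> [g Ig Ju] [g' Ig' Jv]; exists (g + g'); first exact: idealD.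
  by rewrite mulrDr opprD addrACA; apply: idealD.
- move=> [g Ig Ju]; exists (a * g); first exact: idealM.
  by rewrite mulrCA -mulrBr; apply: idealM.
Qed.

Lemma in_submod_mono I I' J J' fs u : (forall v, I v -> I' v) ->
  (forall v, J v -> J' v) -> in_submod I J fs u -> in_submod I' J' fs u.
Proof. by move=> II' JJ' [g [Ig Ju]]; exists g; split=> [j|]; auto. Qed.

Lemma in_submod_base I J fs u : ideal I -> J u -> in_submod I J fs u.
Proof.
move=> iI Ju; apply/in_submodP; exists (fun=> 0); split=> [j _|]; first exact: ideal0.
by rewrite big1 ?subr0 // => j _; rewrite mulr0.
Qed.

(** Regularity without the condition that M/(fs)M is nonzero, so that it passes to extensions and
    holds for the zero module. *)
Definition weakly_regular I J fs := forall k, (k < size fs)%N ->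
  forall u, I u -> in_submod I J (take k fs) (fs`_k * u) ->
  in_submod I J (take k fs) u.

Lemma in_submod_takeS I J fs k u : (k < size fs)%N ->
  in_submod I J (take k.+1 fs) u <->
  exists2 g, I g & in_submod I J (take k fs) (u - fs`_k * g).
Proof. by move=> ltk; rewrite (take_nth 0 ltk) in_submod_rcons. Qed.

(** * Regularity along extensions of modules *)

Section Extension.
Variables (I L J : R -> Prop) (fs : seq R).
Hypotheses (iI : ideal I) (iL : ideal L) (iJ : ideal J).
Hypotheses (LI : forall u, L u -> I u) (JL : forall u, J u -> L u).

(* Exactness of L/J -> I/J -> I/L is preserved modulo a sequence regular on I/L. *)
Lemma in_submod_restrict k u : weakly_regular I L fs -> (k <= size fs)%N ->
  L u -> in_submod I J (take k fs) u -> in_submod L J (take k fs) u.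
Proof.
move=> regIL; elim: k u => [|k IH] u ltk Lu.
  by rewrite take0 !in_submod_nil.
move/(in_submod_takeS _ _ _ ltk)=> [g Ig Hu].
(* Since u is in L, f_k g vanishes in I/L modulo the earlier elements. Regularity there makes g
   congruent to some l in L, which replaces g as the coefficient of f_k. *)
have : in_submod I L (take k fs) g.
  apply: regIL => //; have iIL := in_submod_ideal (take k fs) iI iL.
  have -> : fs`_k * g = u - (u - fs`_k * g) by rewrite opprB addrC subrK.
  by apply: idealB (in_submod_base _ iI Lu) _ => //; apply: in_submod_mono Hu.
move/in_submodP=> [g' [Ig']].
set s := \sum_(_ < _) _; set l := g - s => Lg.
have Hs : in_submod I J (take k fs) s.
  by apply/in_submodP; exists g'; split=> //; rewrite subrr; apply: ideal0.
apply/(in_submod_takeS _ _ _ ltk); exists l => //.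
apply: IH; [exact: ltnW | exact: idealB iL Lu (idealM _ iL Lg) |].
have -> : u - fs`_k * l = (u - fs`_k * g) + fs`_k * s by rewrite /l; ring.
have iIJ := in_submod_ideal (take k fs) iI iJ.
by apply: idealD => //; apply: idealM.
Qed.

(** Regularity on I/L moves u into L up to a combination s of the earlier elements; the relation for
    f_k (u - s) restricts to L/J, where regularity applies again. *)
Lemma weakly_regular_ext :
  weakly_regular I L fs -> weakly_regular L J fs -> weakly_regular I J fs.
Proof.
move=> regIL regLJ k ltk u Iu Hu.
have /in_submodP[g [Ig Ll]] : in_submod I L (take k fs) u.
  by apply: regIL => //; apply: in_submod_mono Hu.
set s := \sum_(_ < _) _ in Ll.
have iIJ := in_submod_ideal (take k fs) iI iJ.
have Hs : in_submod I J (take k fs) s.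
  by apply/in_submodP; exists g; split=> //; rewrite subrr; apply: ideal0.
apply: (ideal_sub iIJ _ Hs).
apply: (in_submod_mono LI (fun _ h => h)).
apply: regLJ => //; apply: in_submod_restrict => //; first exact: ltnW.
  exact: idealM.
by rewrite mulrBr; apply: idealB => //; apply: idealM.
Qed.
End Extension.

Lemma weakly_regular_trivial I J fs : ideal I -> (forall u, I u -> J u) ->
  weakly_regular I J fs.
Proof. by move=> iI IJ k _ u /IJ Ju _; apply: in_submod_base. Qed.

End Ideals.

(** * Regular sequences in a polynomial ring *)

Notation pseq_mod fs := (in_submod (fun=> True) (fun u => u = 0) fs).
Notation pseq_regular fs := (weakly_regular (fun=> True) (fun u => u = 0) fs).

Section RegularRing.
Variable R : comNzRingType.
Implicit Types (fs gs : seq R) (u v f g : R).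

Lemma pseq_mod_ideal fs : ideal (pseq_mod fs).
Proof. exact: in_submod_ideal (@idealT R) (@ideal_eq0 R). Qed.

(** Each f_k is congruent to -g_k modulo the earlier f's, so initial segments generate the same
    ideals. The sum is the form in which [esym_hsym] provides the congruence. *)
Lemma pseq_mod_congr fs gs : size fs = size gs ->
  (forall k, (k < size fs)%N -> pseq_mod (take k fs) (fs`_k + gs`_k)) ->
  forall k u, (k <= size fs)%N -> pseq_mod (take k fs) u <-> pseq_mod (take k gs) u.
Proof.
move=> eqs H; elim=> [|k IH] u ltk; first by rewrite !take0.
have ifs := pseq_mod_ideal (take k fs).
rewrite !in_submod_takeS -?eqs //; split=> -[a _ Ha]; exists (- a) => //.
  apply/IH; first exact: ltnW.
  have -> : u - gs`_k * - a = (u - fs`_k * a) + a * (fs`_k + gs`_k) by ring.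
  by apply: idealD => //; apply: idealM => //; apply: H.
move/(IH _ (ltnW ltk)): Ha => Ha.
have -> : u - fs`_k * - a = (u - gs`_k * a) + a * (fs`_k + gs`_k) by ring.
by apply: idealD => //; apply: idealM => //; apply: H.
Qed.

Lemma pseq_regular_congr fs gs : size fs = size gs ->
  (forall k, (k < size fs)%N -> pseq_mod (take k fs) (fs`_k + gs`_k)) ->
  pseq_regular gs -> pseq_regular fs.
Proof.
move=> eqs H reg k ltk u _ Hu; have E := pseq_mod_congr eqs H.
have ifs := pseq_mod_ideal (take k fs).
apply/E; [exact: ltnW | apply: reg; rewrite -?eqs //].
apply/E; first exact: ltnW.
have -> : gs`_k * u = u * (fs`_k + gs`_k) - fs`_k * u by ring.
by apply: idealB => //; apply: idealM => //; apply: H.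
Qed.

Lemma pseq_mod_polyC fs (p : {poly R}) : pseq_mod (map polyC fs) p <->
  forall i, pseq_mod fs p`_i.
Proof.
elim: fs p => [|f fs IH] p.
  rewrite in_submod_nil; split=> [-> i|H]; first by rewrite in_submod_nil coef0.
  by apply/polyP=> i; have /in_submod_nil := H i; rewrite coef0.
rewrite /= in_submod_cons; split=> [[g _ /IH H] i|H].
  by apply/in_submod_cons; exists g`_i => //; have := H i; rewrite coefB coefCM.
(* One cofactor is chosen for each of the finitely many coefficients of p; together they form a
   polynomial. *)
have [g Hg] : exists g : 'I_(size p) -> R, forall i : 'I_(size p),
    pseq_mod fs (p`_i - f * g i).
  apply: (@fin_all_exists _ (fun=> R)
    (fun (i : 'I_(size p)) a => pseq_mod fs (p`_i - f * a))) => i.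
  by have /in_submod_cons[a _ Ha] := H i; exists a.
exists (\poly_(i < size p) (if insub i is Some o then g o else 0)) => //.
apply/IH=> i; rewrite coefB coefCM coef_poly.
case: ltnP => [lti|le]; first by rewrite insubT; apply: (Hg (Ordinal lti)).
by rewrite nth_default // mulr0 subr0; exact: ideal0 (pseq_mod_ideal fs).
Qed.

(* Reduction modulo [g] is [R]-linear, since [R[X]/(g)] is free over [R]. *)
Lemma pseq_regular_monic (g : {poly R}) fs : g \is monic ->
  pseq_regular fs -> pseq_regular (g :: map polyC fs).
Proof.
move=> mg reg [_ u _ /=|k ltk u _ /=].
  rewrite !in_submod_nil => gu0; apply/eqP.
  have [_ rg] := monic_comreg mg.
  have g0 : (size (0%R : {poly R}) < size g)%N by rewrite size_poly0 size_poly_gt0 monic_neq0.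
  by have := rreg_div0 u rg g0; rewrite addr0 [u * g]mulrC gu0 !eqxx andbT => <-.
rewrite /= size_map in ltk; rewrite (nth_map 0) // -map_take in_submod_cons => -[v _ Hv].
(* Taking remainders commutes with constants, so it preserves the ideal they generate; it also
   erases the multiple g v, leaving a coefficientwise statement over R. *)
have modP cs w : pseq_mod (map polyC cs) w ->
    pseq_mod (map polyC cs) (Pdiv.Ring.rmodp w g).
  elim: cs w => [|c cs IH] w /=; first by rewrite !in_submod_nil => ->; apply: Pdiv.Ring.rmod0p.
  rewrite !in_submod_cons => -[a _ /IH Ha]; exists (Pdiv.Ring.rmodp a g) => //.
  by move: Ha; rewrite mul_polyC Pdiv.RingMonic.rmodpB // Pdiv.RingMonic.rmodpZ // mul_polyC.
apply/in_submod_cons; exists (Pdiv.Ring.rdivp u g) => //.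
have -> : u - g * Pdiv.Ring.rdivp u g = Pdiv.Ring.rmodp u g.
  by rewrite {1}[u](Pdiv.RingMonic.rdivp_eq mg) mulrC addrC addKr.
have /modP := Hv; rewrite Pdiv.RingMonic.rmodpB // mul_polyC Pdiv.RingMonic.rmodpZ //.
rewrite mulrC Pdiv.RingMonic.rmodp_mull // subr0 => /pseq_mod_polyC H.
by apply/pseq_mod_polyC => i; apply: reg => //; have := H i; rewrite coefZ.
Qed.

End RegularRing.

(** * Elementary and complete symmetric polynomials *)

Section Symmetric.
Variable R : comNzRingType.
Implicit Types (x : nat -> R).

(* Complete homogeneous symmetric polynomial of degree [j] in [x 0, ..., x l.-1]. *)
Fixpoint hsym x (l j : nat) : R :=
  if l is l'.+1 then \sum_(i < j.+1) x l' ^+ i * hsym x l' (j - i) else (j == 0)%:R.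

(* Its coefficients are the elementary symmetric polynomials, up to sign. *)
Definition esym_poly x (m : nat) : {poly R} := \prod_(0 <= i < m) (1 - x i *: 'X).

Definition esym_seq x m d : seq R := mkseq (fun i => (esym_poly x m)`_i.+1) d.

Lemma hsym_rec x l j :
  hsym x l.+1 j = \sum_(i < j.+1) x l ^+ i * hsym x l (j - i).
Proof. by []. Qed.

Lemma hsym_deg0 x l : hsym x l 0 = 1.
Proof. by elim: l => //= l IH; rewrite big_ord1 mul1r. Qed.

Lemma hsymS x l j : hsym x l.+1 j.+1 = hsym x l j.+1 + x l * hsym x l.+1 j.
Proof.
rewrite /= big_ord_recl expr0 mul1r subn0; congr (_ + _).
by rewrite mulr_sumr; apply: eq_bigr => i _; rewrite /= exprS mulrA.
Qed.

Arguments hsym : simpl never.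

(** The generating series of the h_j is the product of the 1/(1 - x_i t); the factor 1 - x_l t
    cancels its last term. *)
Lemma hsym_conv x l j (P : {poly R}) :
  \sum_(i < j.+1) ((1 - x l *: 'X) * P)`_i * hsym x l.+1 (j - i) =
  \sum_(i < j.+1) P`_i * hsym x l (j - i).
Proof.
under eq_bigr => i _ do
  rewrite mulrBl mul1r -scalerAl coefB coefZ coefXM mulrBl.
rewrite sumrB big_ord_recr [X in _ - X]big_ord_recl [in RHS]big_ord_recr /=.
rewrite mulr0 mul0r add0r subnn !hsym_deg0 addrAC -sumrB; congr (_ + _).
apply: eq_bigr => i _; rewrite /bump add1n subnS -mulrA mulrCA -mulrBr.
have : (0 < j - i)%N by rewrite subn_gt0.
by case: (j - i)%N => // k _; rewrite hsymS addrK.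
Qed.

Lemma hsym_conv_prod x l j (P : {poly R}) :
  \sum_(i < j.+1) (esym_poly x l * P)`_i * hsym x l (j - i) = P`_j.
Proof.
elim: l P => [|l IH] P.
  rewrite /esym_poly big_geq // mul1r big_ord_recr /= subnn hsym_deg0 mulr1 big1 ?add0r // => i _.
  by rewrite /hsym subn_eq0 leqNgt ltn_ord mulr0.
rewrite /esym_poly big_nat_recr //= -/(esym_poly x l) -mulrA mulrCA hsym_conv.
exact: IH.
Qed.

Lemma coef_prod_small x l k j : (k < j)%N ->
  (\prod_(l <= i < l + k) (1 - x i *: 'X))`_j = 0.
Proof.
elim: k j => [|k IH] [|j] // ltkj.
  by rewrite addn0 big_geq // coef1.
rewrite addnS big_nat_recr ?leq_addr //= mulrC mulrBl mul1r -scalerAl.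
by rewrite coefB coefZ coefXM /= !IH ?mulr0 ?subr0 // ltnW.
Qed.

(** The last k of the m linear factors have a product of degree at most k, whose coefficient of
    degree k + 1 vanishes. By [hsym_conv_prod] this coefficient is a convolution of the e's of all
    variables with the h's of the first m - k. *)
Lemma esym_hsym x m d : (d <= m)%N -> forall k, (k < d)%N ->
  pseq_mod (take k (esym_seq x m d)) ((esym_poly x m)`_k.+1 + hsym x (m - k) k.+1).
Proof.
move=> ledm k ltkd; have ltkm := leq_trans ltkd ledm.
have := hsym_conv_prod x (m - k) k.+1 (\prod_(m - k <= i < m - k + k) (1 - x i *: 'X)).
rewrite coef_prod_small // -big_cat_nat //= ?leq_addr // subnK; last exact: ltnW.
rewrite -/(esym_poly x m) big_ord_recl big_ord_recr /= /bump /= add1n subnn subn0 hsym_deg0 mulr1.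
have -> : (esym_poly x m)`_0 = 1.
  rewrite /esym_poly; elim: (m) => [|l IH]; first by rewrite big_geq // coef1.
  rewrite big_nat_recr //= mulrC mulrBl mul1r -scalerAl.
  by rewrite coefB coefZ coefXM /= mulr0 subr0.
(* The two end terms of the convolution form the stated sum; the k terms between them are multiples
   of earlier members of the sequence. *)
rewrite mul1r addrCA => E; apply/in_submodP.
have sz : size (take k (esym_seq x m d)) = k by rewrite size_takel // size_mkseq ltnW.
exists (fun i => - hsym x (m - k) (k - i)); split=> //; rewrite sz.
rewrite -[RHS]E -sumrN addrC; congr (_ + _); first exact: addrC.
apply: eq_bigr => i _; rewrite mulrN opprK subSS; congr (_ * _).
by rewrite nth_take // nth_mkseq // (ltn_trans _ ltkd).
Qed.

End Symmetric.

Lemma eq_hsym (R S : comNzRingType) (f : {rmorphism R -> S}) x y l j :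
  (forall i, (i < l)%N -> y i = f (x i)) -> hsym y l j = f (hsym x l j).
Proof.
elim: l j => [|l IH] j xy; first by rewrite /hsym rmorph_nat.
rewrite !hsym_rec rmorph_sum; apply: eq_bigr => i _.
by rewrite rmorphM rmorphXn xy // IH // => k ltk; apply: xy; apply: ltnW.
Qed.

(** * The iterated polynomial ring and its universal property *)

Section Mpoly.
Variable K : fieldType.
Local Notation xv m := (xvar K m).

(** Degrees rise from s while variables are dropped from the end. With s free, the tail is a
    sequence of the same kind in one variable fewer, which suits induction on m. *)
Definition hsym_seq m s d : seq (mpoly K m) :=
  mkseq (fun i => hsym (xv m) (m - i) (s + i)) d.

Lemma xvarS m i : (i < m)%N -> xv m.+1 i = (xv m i)%:P.
Proof. by move=> ltim /=; rewrite ltn_eqF. Qed.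

Lemma xvarX m : xv m.+1 m = 'X.
Proof. by rewrite /= eqxx. Qed.

Lemma hsym_xvarS m l j : (l <= m)%N -> hsym (xv m.+1) l j = (hsym (xv m) l j)%:P.
Proof.
by move=> lelm; apply: (eq_hsym (f := polyC)) => i ltil; apply/xvarS/(leq_trans ltil).
Qed.

(** The top power of the last variable has coefficient h_0 = 1. *)
Lemma hsym_monic m s : (hsym (xv m.+1) m.+1 s : {poly mpoly K m}) \is monic.
Proof.
rewrite hsym_rec xvarX big_ord_recr /= subnn hsym_deg0 mulr1.
rewrite monicE lead_coefDr ?lead_coefXn // size_polyXn ltnS.
apply: (leq_trans (size_sum _ _ _)); apply/bigmax_leqP => i _.
rewrite hsym_xvarS // mulrC mul_polyC (leq_trans (size_scale_leq _ _)) //.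
by rewrite size_polyXn.
Qed.

Lemma pseq_regular_hsym m s d : (d <= m)%N -> pseq_regular (hsym_seq m s d).
Proof.
elim: m s d => [|m IH] s [|d] // ledm.
have -> : hsym_seq m.+1 s d.+1 =
    hsym (xv m.+1) m.+1 s :: map polyC (hsym_seq m s.+1 d).
  rewrite /hsym_seq /mkseq [iota 0 d.+1]/= map_cons subn0 addn0; congr (_ :: _).
  rewrite (iotaDl 1 0 d : iota 1 d = _) -!map_comp; apply: eq_map => i.
  rewrite [LHS]/comp [RHS]/comp.
  by rewrite add1n subSS addnS hsym_xvarS ?leq_subr.
exact/pseq_regular_monic/IH/ledm/hsym_monic.
Qed.

Lemma pseq_regular_esym m d : (d <= m)%N -> pseq_regular (esym_seq (xv m) m d).
Proof.
move=> ledm.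
apply: (@pseq_regular_congr _ (esym_seq (xv m) m d) (hsym_seq m 1 d)); last first.
- exact: pseq_regular_hsym.
- by move=> k; rewrite size_mkseq => ltk; rewrite !nth_mkseq // add1n; apply: esym_hsym.
by rewrite !size_mkseq.
Qed.
Lemma xvar_mulI m i (p : mpoly K m) : (i < m)%N -> xv m i * p = 0 -> p = 0.
Proof.
elim: m i p => // m IH i p; rewrite ltnS leq_eqVlt => /orP[/eqP->|ltim].
  rewrite xvarX => E; apply/polyP => k.
  by have := coefXM p k.+1; rewrite E !coef0.
rewrite xvarS // => E; apply/polyP => k; rewrite coef0.
by apply: (IH i) => //; rewrite -coefCM E coef0.
Qed.

Fixpoint mconst m : {rmorphism K -> mpoly K m} :=
  if m is m'.+1 return {rmorphism K -> mpoly K m} then polyC \o mconst m'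
  else idfun.

Lemma mpoly_ind m (P : mpoly K m -> Prop) :
  (forall c, P (mconst m c)) -> (forall i, (i < m)%N -> P (xv m i)) ->
  (forall p q, P p -> P q -> P (p + q)) -> (forall p q, P p -> P q -> P (p * q)) ->
  forall p, P p.
Proof.
elim: m P => [|m IH] P Pc Px PD PM p; first exact: Pc.
have PC (c : mpoly K m) : P c%:P.
  apply: (IH (fun c => P c%:P)) => [a|i lti|a b Pa Pb|a b Pa Pb].
  - exact: Pc.
  - by rewrite -xvarS //; apply/Px/ltnW.
  - by rewrite polyCD; apply: PD.
  - by rewrite polyCM; apply: PM.
elim/poly_ind: p => [|p c Pp]; first exact: PC.
by apply/PD/PC/PM => //; rewrite -xvarX; apply: Px.
Qed.

Lemma mpoly_eval m (A : comNzRingType) (h : {rmorphism K -> A}) (v : nat -> A) :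
  exists f : {rmorphism mpoly K m -> A},
    (forall c, f (mconst m c) = h c) /\ forall i, (i < m)%N -> f (xv m i) = v i.
Proof.
elim: m => [|m [f [fc fx]]]; first by exists h.
have cf : commr_rmorph f (v m) by move=> a; apply: mulrC.
exists (horner_morph cf); split=> [c|i].
  by rewrite /= horner_morphC.
rewrite ltnS leq_eqVlt => /orP[/eqP->|lti]; first by rewrite xvarX; apply: horner_morphX.
by rewrite xvarS // -[RHS]fx //; apply: horner_morphC.
Qed.

(** Agreement modulo an ideal is closed under sums and products, so the generators decide. For the
    zero ideal this is uniqueness in the universal property. *)
Lemma mpoly_morph_congr m (A : comNzRingType) (P : A -> Prop)
    (f g : {rmorphism mpoly K m -> A}) : ideal P ->
  (forall c, f (mconst m c) = g (mconst m c)) ->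
  (forall i, (i < m)%N -> P (f (xv m i) - g (xv m i))) ->
  forall p, P (f p - g p).
Proof.
move=> iP fgc fgx; apply: mpoly_ind => // [c|p q Pp Pq|p q Pp Pq].
- by rewrite fgc subrr; apply: ideal0.
- by rewrite !rmorphD opprD addrACA; apply: idealD.
have -> : f (p * q) - g (p * q) = f p * (f q - g q) + g q * (f p - g p).
  by rewrite !rmorphM; ring.
by apply: idealD => //; apply: idealM.
Qed.

End Mpoly.

(** * Filtration of I/J *)

Section CyclicQuotient.
Variables (R S : comNzRingType) (f : {rmorphism R -> S}) (g : {rmorphism S -> R}).
Variables (I J : R -> Prop) (b : R).
Hypotheses (iI : ideal I) (iJ : ideal J) (Ib : I b).
Hypotheses (fgK : cancel g f) (Jb : forall u, J (b * (u - g (f u)))).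
Hypotheses (Ib_gen : forall u, I u -> exists v, J (u - b * v)).
Hypotheses (fb : forall u, J (b * u) -> f u = 0).

(* Under these hypotheses [I/J] is isomorphic to [S] via [b * u |-> f u]. *)
Lemma in_submod_cyclic fs u :
  in_submod I J fs (b * u) <-> pseq_mod (map f fs) (f u).
Proof.
have Jmod cs v : J v -> in_submod I J cs v by apply: in_submod_base.
elim: fs u => [|c fs IH] u /=.
  rewrite !in_submod_nil; split=> [/fb //|fu0].
  by have := Jb u; rewrite fu0 rmorph0 subr0.
have iM := in_submod_ideal fs iI iJ.
rewrite !in_submod_cons; split=> [[v Iv Hv]|[v _ Hv]].
  have [w Jw] := Ib_gen Iv; exists (f w) => //.
  rewrite -rmorphM -rmorphB; apply/IH.
  have -> : b * (u - c * w) = (b * u - c * v) + c * (v - b * w) by ring.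
  by apply: idealD => //; apply: idealM => //; apply: Jmod.
exists (b * g v); first exact: ideal_mulr.
have -> : b * u - c * (b * g v) = b * (u - c * g v) by ring.
by apply/IH; rewrite rmorphB rmorphM fgK.
Qed.

Lemma weakly_regular_cyclic fs : pseq_regular (map f fs) -> weakly_regular I J fs.
Proof.
move=> reg k ltk u Iu Hu; have [v Jv] := Ib_gen Iu.
have iM := in_submod_ideal (take k fs) iI iJ.
have Mv : in_submod I J (take k fs) (u - b * v) by apply: in_submod_base.
apply: (ideal_sub iM Mv); apply/in_submod_cyclic; rewrite map_take.
apply: reg; rewrite ?size_map // (nth_map 0) // -rmorphM -map_take.
apply/in_submod_cyclic.
have -> : b * (fs`_k * v) = fs`_k * u - fs`_k * (u - b * v) by ring.
by apply: idealB => //; apply: idealM.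
Qed.

End CyclicQuotient.

Section Restriction.
Variables (K : fieldType) (n : nat) (s : seq nat).
Hypotheses (us : uniq s) (sn : all (fun i => i < n)%N s).

(** The map f kills the variables outside s and renumbers the others by their place in s; g restores
    them. Hence p - g (f p) lies in every ideal containing the killed variables. *)
Lemma variable_restriction :
  exists (f : {rmorphism mpoly K n -> mpoly K (size s)})
         (g : {rmorphism mpoly K (size s) -> mpoly K n}),
  [/\ cancel g f,
      forall i, (i < n)%N ->
        f (xvar K n i) = if i \in s then xvar K (size s) (index i s) else 0 &
      forall P, ideal P -> (forall i, (i < n)%N -> i \notin s -> P (xvar K n i)) ->
        forall p, P (p - g (f p))].
Proof.
have [f [fc fx]] := mpoly_eval n (mconst K (size s))
  (fun i => if i \in s then xvar K (size s) (index i s) else 0).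
have [g [gc gx]] := mpoly_eval (size s) (mconst K n) (fun k => xvar K n (nth 0%N s k)).
exists f, g; split=> // [p|P iP Px p].
  have := @mpoly_morph_congr K (size s) _ (fun u => u = 0) (f \o g) idfun.
  move=> /(_ (@ideal_eq0 _)) H; apply/eqP; rewrite -subr_eq0; apply/eqP.
  apply: H => [c|i lti] /=; first by rewrite gc fc.
  rewrite gx // fx; last by apply: (allP sn); apply: mem_nth.
  by rewrite mem_nth // index_uniq // subrr.
have := @mpoly_morph_congr K n _ P idfun (g \o f) iP.
apply=> [c|i lti] /=; first by rewrite fc gc.
rewrite fx //; case: ifP => [is_|/negbT iNs]; last by rewrite rmorph0 subr0; apply: Px.
by rewrite gx ?index_mem // nth_index // subrr; apply: ideal0.
Qed.

(** In the product defining [esym_poly], factors of killed variables become 1 and the others are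
    permuted into the order of s. *)
Lemma map_esym_seq (f : {rmorphism mpoly K n -> mpoly K (size s)}) d :
  (forall i, (i < n)%N ->
     f (xvar K n i) = if i \in s then xvar K (size s) (index i s) else 0) ->
  map f (esym_seq (xvar K n) n d) = esym_seq (xvar K (size s)) (size s) d.
Proof.
move=> fx; rewrite /esym_seq /mkseq -map_comp; apply: eq_map => k.
rewrite [LHS]/comp -coef_map; congr (nth _ (polyseq _) _); rewrite rmorph_prod.
pose F i : {poly mpoly K (size s)} := 1 - xvar K (size s) (index i s) *: 'X.
transitivity (\prod_(i <- index_iota 0 n | i \in s) F i).
  rewrite [RHS]big_mkcond; apply: eq_big_nat => i /andP[_ ltin].
  rewrite rmorphB rmorph1 /= map_polyZ map_polyX fx //.
  by case: ifP => // _; rewrite scale0r subr0.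
rewrite -big_filter; transitivity (\prod_(i <- s) F i).
  apply: perm_big; apply: uniq_perm => //; first by rewrite filter_uniq // iota_uniq.
  move=> i; rewrite mem_filter mem_index_iota; case: (boolP (i \in s)) => //= is_.
  exact: (allP sn).
rewrite (big_nth 0%N); apply: eq_big_nat => i /andP[_ lti].
by rewrite /F index_uniq.
Qed.

End Restriction.

(** * Square free monomial ideals and the induction on the filtration *)

Section SquareFree.
Variables (K : fieldType) (n : nat).
Implicit Types (A B C : {set 'I_n}) (G : seq {set 'I_n}).

Lemma sqfmonoU1 i B : i \notin B -> sqfmono K (i |: B) = xvar K n i * sqfmono K B.
Proof. by move=> iB; rewrite /sqfmono big_setU1. Qed.

Lemma sqfmono_sub P B C : ideal P -> C \subset B -> P (sqfmono K C) -> P (sqfmono K B).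
Proof.
move=> iP CB PC; rewrite /sqfmono (big_setID C) /= (setIidPr CB).
exact: ideal_mulr.
Qed.

Lemma sqf_ideal_ideal G : ideal (@sqf_ideal K n G).
Proof. exact: in_ideal_ideal. Qed.

Lemma sqf_ideal_gen G A : A \in G -> sqf_ideal G (sqfmono K A).
Proof. by move=> AG; apply: in_ideal_gen; apply: map_f. Qed.

Lemma sqf_ideal_sub G P : ideal P -> (forall A, A \in G -> P (sqfmono K A)) ->
  forall u, sqf_ideal G u -> P u.
Proof. by move=> iP GP; apply: in_ideal_sub => // _ /mapP[A AG ->]; apply: GP. Qed.

Lemma pboolP (Q : Prop) : reflect Q (pbool Q).
Proof. by rewrite /pbool; case: excluded_middle_informative => h; constructor. Qed.

(* [B] is maximal among the square free monomials of [I \ J], so [(J + x_B) / J] is a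
   shift of the polynomial ring in the variables of [B]. *)
Lemma weakly_regular_add1 GJ B d : (d <= #|B|)%N ->
  ~ sqf_ideal GJ (sqfmono K B) ->
  (forall i, i \notin B -> sqf_ideal GJ (sqfmono K (i |: B))) ->
  weakly_regular (sqf_ideal (B :: GJ)) (sqf_ideal GJ) (esym_seq (xvar K n) n d).
Proof.
move=> ledB nJB JB; pose s := map val (enum B).
have szs : size s = #|B| by rewrite size_map -cardE.
have us : uniq s by rewrite map_inj_uniq ?enum_uniq //; apply: val_inj.
have sn : all (fun i => i < n)%N s by apply/allP=> _ /mapP[i _ ->]; apply: ltn_ord.
have smem (i : 'I_n) : (val i \in s) = (i \in B).
  by rewrite mem_map ?mem_enum //; apply: val_inj.
have [f [g [fgK fx Pgf]]] := variable_restriction K us sn.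
have iJ := sqf_ideal_ideal GJ; have iL := sqf_ideal_ideal (B :: GJ).
have fJ (u : mpoly K n) : sqf_ideal GJ u -> f u = 0.
  apply: (@sqf_ideal_sub _ (fun v => f v = 0)) => [|C CG].
    by split=> [|v w fv fw|a v fv]; rewrite ?rmorph0 ?rmorphD ?rmorphM ?fv ?fw ?addr0 ?mulr0.
  have /subsetPn[i iC iB] : ~~ (C \subset B).
    by apply/negP=> CB; apply: nJB; apply: sqfmono_sub CB _ => //; apply: sqf_ideal_gen.
  by rewrite /sqfmono rmorph_prod (bigD1 i) //= fx // smem (negbTE iB) mul0r.
apply: (@weakly_regular_cyclic _ _ f g _ _ (sqfmono K B)) => //.
- by apply: sqf_ideal_gen; rewrite inE eqxx.
(* The colon ideal of J by x_B contains every variable outside B, because x_i x_B is in J. *)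
- apply: (Pgf (fun p => sqf_ideal GJ (sqfmono K B * p))).
    split=> [|u v Ju Jv|a u Ju].
    + by rewrite mulr0; apply: ideal0.
    + by rewrite mulrDr; apply: idealD.
    + by rewrite mulrCA; apply: idealM.
  move=> i lti; rewrite -[i]/(val (Ordinal lti)) smem => iB.
  by rewrite mulrC -sqfmonoU1 //; apply: JB.
- apply: (@sqf_ideal_sub _ (fun u => exists v, sqf_ideal GJ (u - sqfmono K B * v))) => [|A].
    split=> [|u v [a Ja] [c Jc]|a u [c Jc]].
    + by exists 0; rewrite mulr0 subr0; apply: ideal0.
    + by exists (a + c); rewrite mulrDr opprD addrACA; apply: idealD.
    + by exists (a * c); rewrite mulrCA -mulrBr; apply: idealM.
  rewrite inE => /orP[/eqP->|AG]; first by exists 1; rewrite mulr1 subrr; apply: ideal0.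
  by exists 0; rewrite mulr0 subr0; apply: sqf_ideal_gen.
(* The image of x_B is a product of variables, each a nonzerodivisor, and is cancelled one variable
   at a time. *)
- move=> u /fJ; rewrite rmorphM /sqfmono rmorph_prod.
  move: (f u); elim/big_rec: _ => [w|i p iB IH w]; first by rewrite mul1r.
  rewrite fx // smem iB -mulrA => /xvar_mulI H; apply/IH/H.
  by rewrite index_mem smem.
by rewrite map_esym_seq //; apply: pseq_regular_esym; rewrite szs.
Qed.

Lemma weakly_regular_esym GI GJ d :
  (forall u, @sqf_ideal K n GJ u -> sqf_ideal GI u) ->
  (forall B, sqf_ideal GI (sqfmono K B) -> (d <= #|B|)%N) ->
  weakly_regular (sqf_ideal GI) (sqf_ideal GJ) (esym_seq (xvar K n) n d).
Proof.
move=> JI degI.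
pose D G := [set B | pbool (sqf_ideal GI (sqfmono K B)) && ~~ pbool (sqf_ideal G (sqfmono K B))].
(* Induction on the number of square free monomials in I \ J. If there are none, I/J is zero;
   otherwise one of largest degree is added to J. *)
have [N] := ubnP #|D GJ|; elim: N => // N IH in GJ JI * => ltN.
have iI := sqf_ideal_ideal GI.
have [D0|[B0 B0D]] := set_0Vmem (D GJ).
  apply: weakly_regular_trivial => // u.
  apply: (sqf_ideal_sub (sqf_ideal_ideal GJ)) => A AG.
  apply/pboolP; have : A \notin D GJ by rewrite D0 inE.
  by rewrite inE negb_and negbK; case: pboolP => //= -[]; apply: sqf_ideal_gen.
pose B := [arg max_(B > B0 in D GJ) #|B|].
have [BD Bmax] : B \in D GJ /\ forall C, C \in D GJ -> (#|C| <= #|B|)%N.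
  by rewrite /B; case: arg_maxnP => // C CD Cmax; split.
have [IB nJB] : sqf_ideal GI (sqfmono K B) /\ ~ sqf_ideal GJ (sqfmono K B).
  by move: BD; rewrite inE => /andP[/pboolP ? /pboolP].
have JL (u : mpoly K n) : sqf_ideal GJ u -> sqf_ideal (B :: GJ) u.
  apply: (sqf_ideal_sub (sqf_ideal_ideal (B :: GJ))) => A AG.
  by apply: sqf_ideal_gen; rewrite inE AG orbT.
have LI (u : mpoly K n) : sqf_ideal (B :: GJ) u -> sqf_ideal GI u.
  apply: (sqf_ideal_sub iI) => A; rewrite inE => /orP[/eqP-> //|AG].
  by apply/JI/sqf_ideal_gen.
apply: (@weakly_regular_ext _ _ (sqf_ideal (B :: GJ))) => //; try exact: sqf_ideal_ideal.
  apply: (IH _ LI); rewrite -ltnS; apply: leq_trans ltN; rewrite ltnS; apply: proper_card.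
  apply/properP; split.
    apply/subsetP=> C; rewrite !inE => /andP[-> /pboolP nL].
    by apply/pboolP => /JL.
  exists B => //; rewrite inE negb_and negbK; apply/orP; right; apply/pboolP.
  by apply: sqf_ideal_gen; rewrite inE eqxx.
apply: weakly_regular_add1 => //; first exact: degI.
move=> i iB; apply: NNPP => nJ.
have : i |: B \in D GJ.
  rewrite inE; apply/andP; split; apply/pboolP => //.
  by apply: sqfmono_sub IB => //; apply: subsetUr.
by move/Bmax; rewrite cardsU1 iB ltnn.
Qed.

End SquareFree.

(** * Koszul homology *)

Section Koszul.
Variables (R : comNzRingType) (n : nat) (x : 'I_n -> R).
Implicit Types (A B : {set 'I_n}) (i j : 'I_n) (z w : {set 'I_n} -> R).

(** The sign of sorting e_i into e_A. A chain is the function sending A to its coefficient at e_A;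
    [kdiff] is the Koszul boundary and [kwedge] is left multiplication by the sum of the c_i e_i. *)
Definition ksign i A : R := (-1) ^+ #|[set j in A | (j < i)%N]|.

Definition kdiff z A : R := \sum_(i | i \notin A) ksign i A * x i * z (i |: A).

Definition kwedge (c : 'I_n -> R) z A : R :=
  \sum_(i in A) ksign i (A :\ i) * c i * z (A :\ i).

Lemma ksignU1 i j A : j \notin A -> ksign i (j |: A) = (-1) ^+ (j < i)%N * ksign i A.
Proof.
move=> jA; rewrite /ksign -exprD; congr (_ ^+ _).
have [ji|ij] := boolP (j < i)%N.
  rewrite (_ : [set _ in _ | _] = j |: [set j in A | (j < i)%N]).
    by rewrite cardsU1 !inE negb_and jA.
  by apply/setP=> k; rewrite !inE; case: eqP => // ->; rewrite ji.
congr #|pred_of_set _|; apply/setP=> k; rewrite !inE; case: eqP => // ->.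
by rewrite (negbTE ij) !andbF.
Qed.

Lemma ksign_sq i A : ksign i A * ksign i A = 1.
Proof. by rewrite -expr2 /ksign sqrr_sign. Qed.

(** Exactly one of i, j precedes the other, so exactly one of the two signs changes. *)
Lemma ksign_anti i j A : i != j -> i \notin A -> j \notin A ->
  ksign i A * ksign j (i |: A) = - (ksign j A * ksign i (j |: A)).
Proof.
move=> ij iA jA; rewrite !ksignU1 //.
have : i != j :> nat by rewrite val_eqE.
by case: ltngtP => //= _ _; rewrite expr0 expr1; ring.
Qed.

Lemma kdiff_sq z A : kdiff (kdiff z) A = 0.
Proof.
pose F i j := ksign i A * ksign j (i |: A) * x i * x j * z (i |: (j |: A)).
have -> : kdiff (kdiff z) A =
    \sum_(i | i \notin A) \sum_(j | (j \notin A) && (i != j)) F i j.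
  apply: eq_bigr => i iA; rewrite mulr_sumr; apply: eq_big => [j|j _].
    by rewrite in_setU1 negb_or eq_sym andbC.
  by rewrite /F setUCA; ring.
rewrite (eq_bigr (fun i => \sum_(j | (j \notin A) && (i < j)%N) F i j +
                           \sum_(j | (j \notin A) && (j < i)%N) F i j)); last first.
  move=> i iA; rewrite (bigID (fun j => (i < j)%N)) /=.
  congr (_ + _); apply: eq_bigl => j; rewrite -andbA; congr (_ && _);
    by rewrite -val_eqE; case: ltngtP.
rewrite big_split /= [X in _ + X](exchange_big_dep (fun j => j \notin A)) /=; last first.
  by move=> i j _ /andP[].
rewrite -big_split big1 //= => i iA.
rewrite [X in _ + X](eq_bigl (fun j => (j \notin A) && (i < j)%N)); last first.
  by move=> j; rewrite iA.
rewrite -big_split big1 //= => j /andP[jA ij].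
rewrite /F (setUCA [set j]) (@ksign_anti j i) //; last by rewrite -val_eqE /= gtn_eqF.
by ring.
Qed.

(** The Leibniz rule. The terms with i = j give c_i x_i z: those with i outside A come from the left
    side, those with i in A from the wedge of the boundary. The mixed terms F cancel. *)
Lemma kdiff_wedge c z A :
  kdiff (kwedge c z) A = (\sum_i c i * x i) * z A - kwedge c (kdiff z) A.
Proof.
pose F i j := ksign i A * ksign j (i |: A :\ j) * x i * c j * z (i |: A :\ j).
have ne i j : i \notin A -> j \in A -> i != j by move=> iA; apply: contraTneq => <-.
have -> : kdiff (kwedge c z) A = \sum_(i | i \notin A) c i * x i * z A +
    \sum_(i | i \notin A) \sum_(j in A) F i j.
  rewrite -big_split /=; apply: eq_bigr => i iA.
  rewrite /kwedge (bigD1 i) ?setU11 //= setU1K //.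
  rewrite mulrDr; congr (_ + _).
    rewrite -[RHS]mul1r -(ksign_sq i A); ring.
  rewrite mulr_sumr; apply: eq_big => [j|j].
    by rewrite in_setU1; case: eqP => [->|_] /=; rewrite ?andbT ?(negbTE iA).
  move=> /andP[_ ji]; have -> : (i |: A) :\ j = i |: A :\ j.
    by rewrite setDUl (_ : [set i] :\ j = [set i]) //; apply/setDidPl; rewrite disjoints1 inE eq_sym.
  by rewrite /F; ring.
have -> : kwedge c (kdiff z) A = \sum_(j in A) c j * x j * z A -
    \sum_(i | i \notin A) \sum_(j in A) F i j.
  rewrite exchange_big /= -sumrB; apply: eq_bigr => j jA.
  rewrite /kdiff (bigD1 j) ?setD11 //= setD1K // mulrDr; congr (_ + _).
    rewrite -[RHS]mul1r -(ksign_sq j (A :\ j)); ring.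
  rewrite mulr_sumr -sumrN; apply: eq_big => [i|i].
    rewrite !inE negb_and negbK; case: eqP => [->|_] /=; rewrite ?andbF ?andbT ?jA //.
  move=> /andP[iAj ij]; rewrite /F.
  have jAj : j \notin A :\ j by rewrite setD11.
  have -> : ksign i A = (-1) ^+ (j < i)%N * ksign i (A :\ j).
    by rewrite -ksignU1 // setD1K.
  have -> : ksign j (i |: A :\ j) = - (-1) ^+ (j < i)%N * ksign j (A :\ j).
    rewrite ksignU1 //; have : i != j :> nat by rewrite val_eqE.
    by case: ltngtP => //= _ _; rewrite expr0 expr1; ring.
  transitivity (((-1) ^+ (j < i)%N * (-1) ^+ (j < i)%N) *
    (ksign j (A :\ j) * c j * (ksign i (A :\ j) * x i * z (i |: A :\ j)))).
    by rewrite -expr2 sqrr_sign mul1r.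
  by ring.
set S := \sum_(i | _) \sum_(j in _) _.
rewrite opprB addrCA [RHS]addrC; congr (_ + _).
by rewrite mulr_suml [X in _ = X - _](bigID (mem A)) /= [X in _ = X - _]addrC addrK.
Qed.

Lemma kdiffB z w A : kdiff (fun B => z B - w B) A = kdiff z A - kdiff w A.
Proof. by rewrite /kdiff -sumrB; apply: eq_bigr => i _; rewrite mulrBr. Qed.

Lemma kdiffZ a z A : kdiff (fun B => a * z B) A = a * kdiff z A.
Proof. by rewrite /kdiff mulr_sumr; apply: eq_bigr => i _; rewrite mulrCA. Qed.

Lemma kdiff_ideal P z : ideal P -> (forall A, P (z A)) -> forall A, P (kdiff z A).
Proof. by move=> iP Pz A; apply: ideal_sum => // i _; apply: idealM. Qed.

Lemma kwedge_ideal P c z : ideal P -> (forall A, P (z A)) -> forall A, P (kwedge c z A).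
Proof. by move=> iP Pz A; apply: ideal_sum => // i _; apply: idealM. Qed.

(** For N inside I: the Koszul homology of I/N in degree p is nonzero, z being a lift of a cycle.
    Since the boundary is graded, w need not be homogeneous. *)
Definition koszul_nontrivial (I N : R -> Prop) (p : nat) := exists z,
  [/\ forall A, I (z A), forall A, #|A| != p -> z A = 0, forall A, N (kdiff z A) &
      ~ exists w, (forall A, I (w A)) /\ forall A, N (z A - kdiff w A)].

(* The connecting map of 0 -> M -f-> M -> M/fM -> 0 is onto, as [f] kills Koszul homology;
   a preimage of the class of [z] is the class of [c /\ z]. *)
Lemma koszul_nontrivial_rcons (I J : R -> Prop) (fs : seq R) f (c : 'I_n -> R) p :
  ideal I -> ideal J -> f = \sum_i c i * x i ->
  (forall u, I u -> in_submod I J fs (f * u) -> in_submod I J fs u) ->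
  koszul_nontrivial I (in_submod I J fs) p ->
  koszul_nontrivial I (in_submod I J (rcons fs f)) p.+1.
Proof.
move=> iI iJ fE regf [z [Iz zp zc znb]].
have iN := in_submod_ideal fs iI iJ; have iN' := in_submod_ideal (rcons fs f) iI iJ.
have NN' u : in_submod I J fs u -> in_submod I J (rcons fs f) u.
  move=> Nu; apply/in_submod_rcons; exists 0; first exact: ideal0.
  by rewrite mulr0 subr0.
have Nf u : I u -> in_submod I J (rcons fs f) (f * u).
  by move=> Iu; apply/in_submod_rcons; exists u => //; rewrite subrr; apply: ideal0.
have wE A : kdiff (kwedge c z) A = f * z A - kwedge c (kdiff z) A.
  by rewrite kdiff_wedge -fE.
have Nw A : in_submod I J fs (kwedge c (kdiff z) A) by exact: kwedge_ideal.
exists (kwedge c z); split.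
- exact: kwedge_ideal.
- move=> A Ap; rewrite /kwedge big1 // => j jA; rewrite zp ?mulr0 //.
  by move: Ap; rewrite (cardsD1 j) jA.
- by move=> A; rewrite wE; apply: idealB (Nf _ (Iz A)) (NN' _ (Nw A)).
move=> [w [Iw Nzw]]; apply: znb.
have [g Ig] : exists g, forall A, I (g A) /\ in_submod I J fs (kwedge c z A - kdiff w A - f * g A).
  apply: (@fin_all_exists _ (fun=> R)
    (fun A u => I u /\ in_submod I J fs (kwedge c z A - kdiff w A - f * u))) => A.
  by have /in_submod_rcons[u Iu Hu] := Nzw A; exists u.
exists g; split=> [A|A]; first by case: (Ig A).
apply: regf; first by apply: idealB => //; apply: kdiff_ideal => // B; case: (Ig B).
(* Applying the boundary to c /\ z = dw + f g kills dw and leaves f (z - dg) = 0 modulo (fs)I + J;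
   regularity of f then makes z the boundary of g. *)
have : in_submod I J fs (kdiff (fun A => kwedge c z A - kdiff w A - f * g A) A).
  by apply: kdiff_ideal => // B; case: (Ig B).
rewrite !kdiffB kdiffZ kdiff_sq wE subr0 => H.
have -> : f * (z A - kdiff g A) =
  f * z A - kwedge c (kdiff z) A - f * kdiff g A + kwedge c (kdiff z) A by ring.
by apply: idealD.
Qed.

Lemma koszul_nontrivial_regular (I J : R -> Prop) (fs : seq R) p :
  ideal I -> ideal J ->
  (forall k, (k < size fs)%N -> exists c : 'I_n -> R, fs`_k = \sum_i c i * x i) ->
  weakly_regular I J fs -> koszul_nontrivial I J p -> (p + size fs <= n)%N.
Proof.
move=> iI iJ fsx regfs HJ.
have H k : (k <= size fs)%N -> koszul_nontrivial I (in_submod I J (take k fs)) (p + k)%N.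
  elim: k => [|k IH] ltk.
    rewrite take0 addn0; have [z [Iz zp zc znb]] := HJ.
    exists z; split=> // [A|[w [Iw Nw]]]; first exact/in_submod_nil.
    by apply: znb; exists w; split=> // A; apply/in_submod_nil.
  have [c cE] := fsx k ltk.
  rewrite (take_nth 0 ltk) addnS; apply: koszul_nontrivial_rcons cE _ _ => //.
    exact: regfs.
  by apply: IH; apply: ltnW.
have [z [Iz zp _ znb]] := H _ (leqnn _).
(* No set of indices has more than n elements, so a class in higher degree is zero. *)
rewrite leqNgt; apply/negP => ltn; apply: znb; exists (fun=> 0); split=> A.
  exact: ideal0.
rewrite zp ?sub0r; last by rewrite neq_ltn (leq_ltn_trans _ ltn) // -[X in (_ <= X)%N](card_ord n) max_card.
have iN := in_submod_ideal (take (size fs) fs) iI iJ.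
by apply: idealN => //; apply: kdiff_ideal => // B; apply: ideal0.
Qed.

End Koszul.

(** * The Koszul cycle and the theorem *)

Section Order.
Variables (K : fieldType) (n : nat).
Implicit Types (A B C : {set 'I_n}) (G : seq {set 'I_n}) (u v : mpoly K n).

Definition order_ge (f : mpoly K n -> {poly K}) d u := exists q, f u = 'X^d * q.

Lemma order_ge_ideal (f : {rmorphism mpoly K n -> {poly K}}) d : ideal (order_ge f d).
Proof.
split=> [|u v [q fq] [r fr]|a u [q fq]].
- by exists 0; rewrite rmorph0 mulr0.
- by exists (q + r); rewrite rmorphD fq fr mulrDr.
- by exists (f a * q); rewrite rmorphM fq mulrCA.
Qed.

Lemma order_geM (f : {rmorphism mpoly K n -> {poly K}}) d e u v :
  order_ge f d u -> order_ge f e v -> order_ge f (d + e) (u * v).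
Proof.
by move=> [q fq] [r fr]; exists (q * r); rewrite rmorphM fq fr exprD; ring.
Qed.

(* Detects the coefficient of [x_B] in a polynomial of order at least [#|B|]. *)
Lemma diagonal_eval B : exists f : {rmorphism mpoly K n -> {poly K}},
  [/\ forall c, f (mconst K n c) = c%:P, f (sqfmono K B) = 'X^#|B|,
      forall i, (i < n)%N -> order_ge f 1 (xvar K n i) &
      forall G d, (forall A, A \in G -> (d <= #|A|)%N) ->
        forall u, sqf_ideal G u -> order_ge f d u].
Proof.
(* Variables of B go to X and the others to 0, so x_A goes to X^|A| if A is inside B and to 0
   otherwise. *)
pose v i : {poly K} := (if insub i is Some o then o \in B else false)%:R *: 'X.
have [f [fc fx]] := mpoly_eval n (polyC : {rmorphism K -> {poly K}}) v.
have fA A : f (sqfmono K A) = (\prod_(i in A) (i \in B)%:R) *: 'X^#|A|.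
  rewrite /sqfmono rmorph_prod -prodr_const -scaler_prod.
  by apply: eq_bigr => i _; rewrite fx // /v valK.
exists f; split=> //.
- by rewrite fA big1 ?scale1r // => i ->.
- by move=> i lti; rewrite /order_ge fx // /v -mul_polyC mulrC; eexists.
move=> G d Gd; apply: (sqf_ideal_sub (order_ge_ideal f d)) => A /Gd ledA.
by rewrite /order_ge fA -mul_polyC -(subnKC ledA) exprD mulrC -mulrA; eexists.
Qed.

Lemma diagonal_eval_eq0 (f : {rmorphism mpoly K n -> {poly K}}) B c :
  (forall c, f (mconst K n c) = c%:P) -> f (sqfmono K B) = 'X^#|B| ->
  order_ge f #|B|.+1 (mconst K n c * sqfmono K B) -> c = 0.
Proof.
move=> fc fB [q]; rewrite rmorphM fc fB => /(congr1 (fun p : {poly K} => p`_#|B|)).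
by rewrite coefCM coefXn eqxx mulr1 coefXnM ltnSn.
Qed.

Lemma sqf_ideal_card_ge G d B : (forall A, A \in G -> (d <= #|A|)%N) ->
  sqf_ideal G (sqfmono K B) -> (d <= #|B|)%N.
Proof.
move=> Gd GB; have [f [fc fB _ fG]] := diagonal_eval B.
rewrite leqNgt; apply/negP=> ltBd.
have [q fq] := fG G d Gd _ GB.
suff /eqP : (1 : K) = 0 by rewrite oner_eq0.
apply: (diagonal_eval_eq0 (B := B) fc fB); rewrite rmorph1 mul1r.
by exists ('X^(d - #|B|.+1) * q); rewrite mulrA -exprD subnKC.
Qed.

End Order.

(** * Nonzero solutions of underdetermined linear systems *)

Section LinearSystem.
Variables (K : fieldType) (T : finType) (U W : {set T}) (a : T -> T -> K).

Lemma underdetermined_solution : (#|W| < #|U|)%N -> exists y : T -> K,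
  [/\ exists2 B, B \in U & y B != 0, forall B, B \notin U -> y B = 0 &
      forall C, C \in W -> \sum_(B in U) y B * a B C = 0].
Proof.
move=> ltWU.
pose M : 'M[K]_(#|U|, #|W|) := \matrix_(i, j) a (enum_val i) (enum_val j).
have : kermx M != 0.
  rewrite -mxrank_eq0 mxrank_ker subn_eq0 -ltnNge.
  exact: leq_ltn_trans (rank_leq_col M) ltWU.
move=> /rowV0Pn[v /sub_kermxP vM v0].
pose y B := \sum_i v 0 i * (enum_val i == B)%:R.
have yE i : y (enum_val i) = v 0 i.
  rewrite /y (bigD1 i) //= eqxx mulr1 big1 ?addr0 // => j /negbTE ji.
  by rewrite (inj_eq enum_val_inj) ji mulr0.
exists y; split.
- have [i vi] := rV0Pn _ v0.
  by exists (enum_val i); [exact: enum_valP | rewrite yE].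
- move=> B BU; rewrite /y big1 // => i _; case: eqP => [iB|_]; last by rewrite mulr0.
  by move: BU; rewrite -iB enum_valP.
move=> C CW; rewrite big_enum_val -[C](enum_rankK_in CW) //.
have /matrixP/(_ 0 (enum_rank_in CW C)) := vM; rewrite !mxE => E; rewrite -[RHS]E.
by apply: eq_bigr => i _; rewrite yE mxE.
Qed.

End LinearSystem.

Section Cycle.
Variables (K : fieldType) (n d : nat) (GI GJ : seq {set 'I_n}).
Implicit Types (A B C : {set 'I_n}).
Local Notation I := (@sqf_ideal K n GI).
Local Notation J := (@sqf_ideal K n GJ).
Hypothesis GId : forall A, A \in GI -> (d <= #|A|)%N.
Hypothesis GJd : forall A, A \in GJ -> (d.+1 <= #|A|)%N.
Hypothesis JI : forall f, J f -> I f.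
Hypothesis rho_lt : (rho d.+1 I - rho d.+1 J < rho d I)%N.

(* The cycle is [\sum_B y_B x_B e_(~: B)] over [#|B| = d], [x_B \in I]. Its boundary has one
   coefficient for each [x_C \in I \ J] with [#|C| = d.+1], so some [y != 0] works. *)
Lemma koszul_cycle : koszul_nontrivial (fun i : 'I_n => xvar K n i) I J (n - d).
Proof.
pose U := [set B : {set 'I_n} | (#|B| == d) && pbool (I (sqfmono K B))].
pose WI := [set C : {set 'I_n} | (#|C| == d.+1) && pbool (I (sqfmono K C))].
pose WJ := [set C : {set 'I_n} | (#|C| == d.+1) && pbool (J (sqfmono K C))].
have WJI : WJ \subset WI.
  apply/subsetP=> C; rewrite !inE => /andP[-> /pboolP JC].
  by apply/pboolP/JI.
have ltWU : (#|WI :\: WJ| < #|U|)%N by rewrite cardsD (setIidPr WJI).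
(* The coefficient of the unknown y_B in the boundary at the complement of C: a Koszul sign if B is
   C without one point, and 0 otherwise. *)
pose a (B C : {set 'I_n}) : K := \sum_(k in C) ksign K k (~: C) * (B == C :\ k)%:R.
have [y [[B0 B0U yB0] yU ya]] := underdetermined_solution a ltWU.
have yI (B : {set 'I_n}) : I (mconst K n (y B) * sqfmono K B).
  have [->|yB] := eqVneq (y B) 0.
    by rewrite rmorph0 mul0r; exact: ideal0 (sqf_ideal_ideal K GI).
  have : B \in U by apply: contraNT yB => /yU ->.
  by rewrite inE => /andP[_ /pboolP IB]; apply: idealM => //; apply: sqf_ideal_ideal.
pose z (A : {set 'I_n}) := mconst K n (y (~: A)) * sqfmono K (~: A).
exists z; split=> [A|A An|A|[w [Iw Jw]]].
- exact: yI.
- rewrite /z yU ?rmorph0 ?mul0r // inE negb_and; apply/orP; left.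
  apply: contra An => /eqP <-; apply/eqP.
  by have := cardsC A; rewrite card_ord => cA; rewrite -[X in (X - _)%N]cA addnK.
- have iJ := sqf_ideal_ideal K GJ.
  set C := ~: A; have -> : kdiff (fun i : 'I_n => xvar K n i) z A =
      mconst K n (\sum_(k in C) ksign K k A * y (C :\ k)) * sqfmono K C.
    rewrite rmorph_sum mulr_suml; apply: eq_big => [k|k kA]; first by rewrite inE.
    rewrite /z setCU setIC -setDE -/C rmorphM.
    have -> : mconst K n (ksign K k A) = ksign _ k A by apply: rmorph_sign.
    have -> : sqfmono K C = xvar K n k * sqfmono K (C :\ k).
      by rewrite -sqfmonoU1 ?setD11 // setD1K // inE.
    by ring.
  (* Three cases: all y_(C minus k) vanish; or x_C is in J; or C indexes an equation of the system
     solved by y. *)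
  have [/existsP[k /andP[kC yk]]|/existsPn y0] :=
      boolP [exists k, (k \in C) && (y (C :\ k) != 0)]; last first.
    rewrite big1 ?rmorph0 ?mul0r; first exact: ideal0.
    by move=> k kC; have := y0 k; rewrite kC negbK => /eqP ->; rewrite mulr0.
  have CkU : C :\ k \in U by apply: contraNT yk => /yU ->.
  have cC : #|C| == d.+1.
    by move: CkU; rewrite inE (cardsD1 k C) kC add1n eqSS => /andP[].
  have IC : I (sqfmono K C).
    apply: (sqfmono_sub (sqf_ideal_ideal K GI) (subD1set C k)).
    by move: CkU; rewrite inE => /andP[_ /pboolP].
  have [CJ|nCJ] := boolP (C \in WJ).
    by apply: idealM => //; move: CJ; rewrite inE => /andP[_ /pboolP].
  have CW : C \in WI :\: WJ.
    by rewrite in_setD nCJ inE cC; apply/pboolP.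
  have : \sum_(k in C) ksign K k A * y (C :\ k) = 0.
    rewrite -[RHS](ya C CW) /a; under [RHS]eq_bigr => B _ do rewrite mulr_sumr.
    rewrite exchange_big /=; apply: eq_bigr => j jC; rewrite /C setCK -/C.
    have [CjU|nCjU] := boolP (C :\ j \in U).
      rewrite (bigD1 _ CjU) /= eqxx big1 ?addr0; first by rewrite mulr1 mulrC.
      by move=> B /andP[_ /negbTE ->]; rewrite !mulr0.
    rewrite yU // mulr0 big1 // => B BU; case: eqP => [BE|]; last by rewrite !mulr0.
    by rewrite -BE BU in nCjU.
  by move=> ->; rewrite rmorph0 mul0r; apply: ideal0.
(* At the complement of B0, both the boundary of w and the error in J have order at least d + 1,
   while y_B0 x_B0 has order d unless y_B0 = 0. *)
- have iJ := sqf_ideal_ideal K GJ; have [f [fc fB fx fG]] := diagonal_eval K B0.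
  have cB0 : #|B0| = d by move: B0U; rewrite inE => /andP[/eqP].
  move/eqP: yB0; apply; apply: (diagonal_eval_eq0 fc fB).
  have iO := order_ge_ideal f #|B0|.+1.
  have := fG _ _ GJd _ (Jw (~: B0)); rewrite /z setCK -cB0 => H.
  apply: (ideal_sub iO H); apply: ideal_sum => // i _.
  rewrite mulrAC -addn1; apply: order_geM; last exact: fx.
  apply: idealM; first exact: order_ge_ideal.
  by apply: (fG GI) => //; rewrite cB0.
Qed.

End Cycle.

(** * Elements of the maximal ideal and the computation of the depth *)

Lemma max_idealP (K : fieldType) n (f : mpoly K n) : max_ideal f ->
  exists c : 'I_n -> mpoly K n, f = \sum_i c i * xvar K n i.
Proof.
move=> /in_idealP[c]; rewrite size_map size_iota => ->.
exists (fun i => c i); apply: eq_bigr => i _.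
by rewrite (nth_map 0%N) ?size_iota // nth_iota.
Qed.

Lemma esym_poly_max_ideal (K : fieldType) n m k : (m <= n)%N ->
  max_ideal ((esym_poly (xvar K n) m)`_k.+1).
Proof.
have iM : ideal (@max_ideal K n) by apply: in_ideal_ideal.
elim: m k => [|m IH] k ltmn.
  by rewrite /esym_poly big_geq // coef1; apply: ideal0.
rewrite /esym_poly big_nat_recr //= mulrC mulrBl mul1r -scalerAl coefB coefZ coefXM /=.
apply: idealB => //; first by apply: IH; apply: ltnW.
apply: ideal_mulr => //; apply: in_ideal_gen; apply: map_f.
by rewrite mem_iota.
Qed.

Theorem theorem2p2 (K : fieldType) (n d : nat) (GI GJ : seq {set 'I_n}) :
  (0 < d)%N ->
  (forall A, A \in GI -> (d <= #|A|)%N) ->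
  (forall A, A \in GJ -> (d.+1 <= #|A|)%N) ->
  GJ != [::] ->
  (forall f, @sqf_ideal K n GJ f -> @sqf_ideal K n GI f) ->
  (exists f, @sqf_ideal K n GI f /\ ~ @sqf_ideal K n GJ f) ->
  (rho d.+1 (@sqf_ideal K n GI) - rho d.+1 (@sqf_ideal K n GJ) < rho d (@sqf_ideal K n GI))%N ->
  depth_eq (@sqf_ideal K n GI) (@sqf_ideal K n GJ) (@max_ideal K n) d.
Proof.
move=> _ GId GJd _ JI _ rho_lt.
have [iI iJ] := (sqf_ideal_ideal K GI, sqf_ideal_ideal K GJ).
(* The strict inequality yields a monomial of degree d in I. It witnesses M/(e_1, ..., e_d)M
   nonzero, as (e_1, ..., e_d)I + J has order at least d + 1, and it gives d <= n. *)
have [B0] : exists B0, B0 \in [set B : {set 'I_n} |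
    (#|B| == d) && pbool (@sqf_ideal K n GI (sqfmono K B))].
  by apply/set0Pn; rewrite -card_gt0; apply: leq_ltn_trans rho_lt.
rewrite inE => /andP[/eqP cB0 /pboolP IB0].
have maxP j : (j < size (esym_seq (xvar K n) n d))%N ->
    max_ideal (esym_seq (xvar K n) n d)`_j.
  by rewrite size_mkseq => ltj; rewrite nth_mkseq //; apply: esym_poly_max_ideal.
split.
  exists (esym_seq (xvar K n) n d); split; first by rewrite size_mkseq.
  split=> //; split.
    by apply: weakly_regular_esym => // B; apply: sqf_ideal_card_ge.
  exists (sqfmono K B0); split=> // /in_submodP[g [Ig Jg]].
  have [f [fc fB fx fG]] := diagonal_eval K B0.
  suff /eqP : (1 : K) = 0 by rewrite oner_eq0.
  apply: (diagonal_eval_eq0 fc fB); rewrite rmorph1 mul1r cB0.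
  have iO := order_ge_ideal f.
  apply: (ideal_sub (iO _) (fG _ _ GJd _ Jg)); apply: ideal_sum => // j _.
  rewrite -add1n; apply: order_geM; last exact: (fG GI _ GId _ (Ig j (ltn_ord j))).
  have [c ->] := max_idealP (maxP j (ltn_ord j)).
  by apply: ideal_sum => // i _; apply: idealM => //; apply: fx.
move=> [fs [szfs [mfs [regfs _]]]].
have fsx k : (k < size fs)%N -> exists c : 'I_n -> mpoly K n, fs`_k = \sum_i c i * xvar K n i.
  by move=> ltk; apply/max_idealP/mfs.
(* The bound reads (n - d) + (d + 1) <= n, which is absurd since d <= n. *)
have := koszul_nontrivial_regular iI iJ fsx regfs (koszul_cycle GId GJd JI rho_lt).
rewrite szfs addnS subnK ?ltnn //.
by rewrite -cB0 -[X in (_ <= X)%N]card_ord max_card.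
Qed.
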